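(* Let $\mathfrak{A}$ be a $C^*$-algebra, let $\mathscr{H},\mathscr{K},\mathscr{L}$ be Hilbert $\mathfrak{A}$-modules, and let $A\in\mathcal{L}(\mathscr{H},\mathscr{K})$ be semi-regular. Then for any $C\in\mathcal{L}(\mathscr{L},\mathscr{K})$, the operator equation $$AX=C,\quad X\in\mathcal{L}(\mathscr{L},\mathscr{H})$$ has a solution if and only if $\mathcal{R}(C)\subseteq\mathcal{R}(A)$. In such case, the general solution of this equation has the form $$X=D+(I-U_A^*U_A)Y,$$ where $D\in\mathcal{L}(\mathscr{L},\mathscr{H})$ is the reduced solution of $AX=C$, $U_A\in\mathcal{L}(\mathscr{H},\mathscr{K})$ is the partial isometry associated with $A$, and $Y\in\mathcal{L}(\mathscr{L},\mathscr{H})$ is arbitrary.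
   Context: For Hilbert $\mathfrak{A}$-modules $\mathscr{H},\mathscr{K}$, $\mathcal{L}(\mathscr{H},\mathscr{K})$ denotes the set of adjointable operators from $\mathscr{H}$ to $\mathscr{K}$, and $\mathcal{R}(\cdot)$ denotes the range. A closed submodule $M$ of $\mathscr{H}$ is orthogonally complemented if $\mathscr{H}=M\oplus M^\perp$, where $M^\perp=\{x\in\mathscr{H}:\langle x,y\rangle=0 \text{ for any } y\in M\}$; then $P_M$ denotes the projection from $\mathscr{H}$ onto $M$. An operator $A\in\mathcal{L}(\mathscr{H},\mathscr{K})$ is semi-regular if $\overline{\mathcal{R}(A)}$ and $\overline{\mathcal{R}(A^* )}$ are orthogonally complemented in $\mathscr{K}$ and $\mathscr{H}$, respectively. For semi-regular $A$ there is a unique partial isometry $U_A\in\mathcal{L}(\mathscr{H},\mathscr{K})$ such that $A=U_A(A^*A)^{1/2}$ and $U_A^*U_A=P_{\overline{\mathcal{R}(A^* )}}$ (known fact); this is the partial isometry associated with $A$. The reduced solution of $AX=C$ is the operator $D\in\mathcal{L}(\mathscr{L},\mathscr{H})$ with $AD=C$ and $\mathcal{R}(D)\subseteq\overline{\mathcal{R}(A^* )}$; it is unique if it exists, and it is known to exist whenever $\overline{\mathcal{R}(A^* )}$ is orthogonally complemented and $\mathcal{R}(C)\subseteq\mathcal{R}(A)$. *)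

(* Defs.v *)
(* MathComp / MathComp-Analysis; complex scalars are R[i] (real_closed). *)
From HB Require Import structures.
From mathcomp Require Import all_boot all_order all_algebra.
From mathcomp Require Import complex.
From mathcomp Require Import boolp classical_sets reals topology normedtype.

Set Implicit Arguments.
Unset Strict Implicit.
Unset Printing Implicit Defensive.

Import Order.TTheory GRing.Theory Num.Theory.
Import numFieldNormedType.Exports.

Local Open Scope classical_set_scope.
Local Open Scope ring_scope.
Local Open Scope complex_scope.

(* Complex C*-algebras, not assumed unital: MathComp's rings all have a unit,
   so the multiplication is given as a separate operation on the Banach space.
   The norm is valued in R[i], with real nonnegative values. *)
HB.mixin Record isCStarAlgebra (R : realType) A of CompleteNormedModule R[i] A := {
  cmul : A -> A -> A;
  star : A -> A;
  cmulA : associative cmul;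
  cmulDl : left_distributive cmul +%R;
  cmulDr : right_distributive cmul +%R;
  cscaleAl : forall (l : R[i]) (a b : A), cmul (l *: a) b = l *: cmul a b;
  cscaleAr : forall (l : R[i]) (a b : A), cmul a (l *: b) = l *: cmul a b;
  starK : involutive star;
  starD : {morph star : a b / a + b};
  starZ : forall (l : R[i]) (a : A), star (l *: a) = l^* *: star a;
  starM : forall a b : A, star (cmul a b) = cmul (star b) (star a);
  cnormM : forall a b : A, `|cmul a b| <= `|a| * `|b|;
  cnormS : forall a : A, `|cmul (star a) a| = `|a| ^+ 2
}.

#[short(type="cstarAlgType")]
HB.structure Definition CStarAlgebra (R : realType) :=
  {A of isCStarAlgebra R A & CompleteNormedModule R[i] A}.

(* Equivalently, a is self-adjoint with nonnegative spectrum. *)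
Definition cstar_pos (R : realType) (A : cstarAlgType R) (a : A) : Prop :=
  exists b : A, a = cmul (star b) b.

(* Hilbert C*-modules: right modules, with an A-valued inner product that is
   linear in its second argument and conjugate-linear in the first. The norm
   of the underlying Banach space is the one induced by the inner product
   (inner_norm); completeness is part of CompleteNormedModule. *)
HB.mixin Record isHilbertModule (R : realType) (A : cstarAlgType R) H
    of CompleteNormedModule R[i] H := {
  ract : H -> A -> H;
  inner : H -> H -> A;
  ractDl : forall (x y : H) (a : A), ract (x + y) a = ract x a + ract y a;
  ractDr : forall (x : H) (a b : A), ract x (a + b) = ract x a + ract x b;
  ractA : forall (x : H) (a b : A), ract (ract x a) b = ract x (cmul a b);
  ractZl : forall (l : R[i]) (x : H) (a : A), ract (l *: x) a = l *: ract x a;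
  ractZr : forall (l : R[i]) (x : H) (a : A), ract x (l *: a) = l *: ract x a;
  innerDr : forall x y z : H, inner x (y + z) = inner x y + inner x z;
  innerZr : forall (l : R[i]) (x y : H), inner x (l *: y) = l *: inner x y;
  innerMr : forall (x y : H) (a : A), inner x (ract y a) = cmul (inner x y) a;
  inner_star : forall x y : H, inner y x = star (inner x y);
  inner_pos : forall x : H, cstar_pos (inner x x);
  inner_eq0 : forall x : H, inner x x = 0 -> x = 0;
  inner_norm : forall x : H, `|x| ^+ 2 = `|inner x x|
}.

#[short(type="hilbertModType")]
HB.structure Definition HilbertModule (R : realType) (A : cstarAlgType R) :=
  {H of isHilbertModule R A H & CompleteNormedModule R[i] H}.

Section InnerTheory.
Context {R : realType} {A : cstarAlgType R}.

Lemma star0 : star (0 : A) = 0.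
Proof. by apply: (addrI (star (0 : A))); rewrite -starD !addr0. Qed.

Lemma starN (a : A) : star (- a) = - star a.
Proof. by apply: (addrI (star a)); rewrite -starD !subrr star0. Qed.

Lemma inner0r (H : hilbertModType A) (x : H) : inner x 0 = 0.
Proof. by apply: (addrI (inner x 0)); rewrite -innerDr !addr0. Qed.

Lemma innerNr (H : hilbertModType A) (x y : H) : inner x (- y) = - inner x y.
Proof. by apply: (addrI (inner x y)); rewrite -innerDr !subrr inner0r. Qed.

Lemma innerDl (H : hilbertModType A) (x y z : H) :
  inner (x + y) z = inner x z + inner y z.
Proof. by rewrite inner_star innerDr starD -!inner_star. Qed.

Lemma inner0l (H : hilbertModType A) (x : H) : inner 0 x = 0.
Proof. by rewrite inner_star inner0r star0. Qed.

Lemma innerNl (H : hilbertModType A) (x y : H) : inner (- x) y = - inner x y.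
Proof. by rewrite inner_star innerNr starN -inner_star. Qed.

End InnerTheory.

(* The set of adjointable operators from H to K. Only the existence of an
   adjoint is required: linearity and boundedness follow from it. *)
Record adjointable (R : realType) (A : cstarAlgType R)
    (H K : hilbertModType A) := Adjointable {
  adj_fun :> H -> K;
  adjP : exists S : K -> H,
    forall (x : H) (y : K), inner (adj_fun x) y = inner x (S y)
}.

Notation "''L' ( H , K )" := (adjointable H K)
  (at level 8, format "''L' ( H ,  K )") : type_scope.

Section Operators.
Context {R : realType} {A : cstarAlgType R}.
Implicit Types H K M : hilbertModType A.

Lemma adjointable_ext H K (T S : 'L(H, K)) : T =1 S -> T = S.
Proof.
case: T S => [f pf] [g pg] /= /funext fg; subst g.
by congr Adjointable; exact: Prop_irrelevance.
Qed.

Definition adj_dual H K (T : 'L(H, K)) : K -> H := sval (cid (adjP T)).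

Lemma adj_dualP H K (T : 'L(H, K)) (x : H) (y : K) :
  inner (T x) y = inner x (adj_dual T y).
Proof. by rewrite /adj_dual; case: cid => S /= ->. Qed.

Fact adj_subproof H K (T : 'L(H, K)) : exists S : H -> K,
  forall (x : K) (y : H), inner (adj_dual T x) y = inner x (S y).
Proof. by exists T => x y; rewrite inner_star -adj_dualP -inner_star. Qed.
Definition adj H K (T : 'L(H, K)) : 'L(K, H) := Adjointable (adj_subproof T).

Fact idop_subproof H : exists S : H -> H,
  forall x y : H, inner (idfun x) y = inner x (S y).
Proof. by exists idfun. Qed.
Definition idop H : 'L(H, H) := Adjointable (idop_subproof H).

Fact compop_subproof H K M (T : 'L(K, M)) (S : 'L(H, K)) : exists Q : M -> H,
  forall (x : H) (y : M), inner ((T \o S) x) y = inner x (Q y).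
Proof. by exists (adj_dual S \o adj_dual T) => x y /=; rewrite !adj_dualP. Qed.
Definition compop H K M (T : 'L(K, M)) (S : 'L(H, K)) : 'L(H, M) :=
  Adjointable (compop_subproof T S).

Fact zeroop_subproof H K : exists S : K -> H,
  forall (x : H) (y : K), inner (0 : K) y = inner x (S y).
Proof. by exists (fun=> 0) => x y; rewrite inner0l inner0r. Qed.
Definition zeroop H K : 'L(H, K) :=
  @Adjointable R A H K (fun=> 0) (zeroop_subproof H K).

Fact addop_subproof H K (T S : 'L(H, K)) : exists Q : K -> H,
  forall (x : H) (y : K), inner (T x + S x) y = inner x (Q y).
Proof.
exists (fun y => adj_dual T y + adj_dual S y) => x y.
by rewrite innerDl innerDr !adj_dualP.
Qed.
Definition addop H K (T S : 'L(H, K)) : 'L(H, K) :=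
  @Adjointable R A H K (fun x => T x + S x) (addop_subproof T S).

Fact oppop_subproof H K (T : 'L(H, K)) : exists Q : K -> H,
  forall (x : H) (y : K), inner (- T x) y = inner x (Q y).
Proof.
by exists (fun y => - adj_dual T y) => x y; rewrite innerNl innerNr adj_dualP.
Qed.
Definition oppop H K (T : 'L(H, K)) : 'L(H, K) :=
  @Adjointable R A H K (fun x => - T x) (oppop_subproof T).

HB.instance Definition _ H K := gen_eqMixin 'L(H, K).
HB.instance Definition _ H K := gen_choiceMixin 'L(H, K).

Fact addopA H K : associative (@addop H K).
Proof. by move=> T S Q; apply: adjointable_ext => x /=; rewrite addrA. Qed.
Fact addopC H K : commutative (@addop H K).
Proof. by move=> T S; apply: adjointable_ext => x /=; rewrite addrC. Qed.
Fact add0op H K : left_id (zeroop H K) (@addop H K).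
Proof. by move=> T; apply: adjointable_ext => x /=; rewrite add0r. Qed.
Fact addNop H K : left_inverse (zeroop H K) (@oppop H K) (@addop H K).
Proof. by move=> T; apply: adjointable_ext => x /=; rewrite addNr. Qed.

HB.instance Definition _ H K := GRing.isZmodule.Build 'L(H, K)
  (@addopA H K) (@addopC H K) (@add0op H K) (@addNop H K).

End Operators.

Notation "T ^*L" := (adj T) (at level 2, format "T ^*L") : ring_scope.
Notation "T \oL S" := (compop T S)
  (at level 40, left associativity, format "T  \oL  S") : ring_scope.

Section Notions.
Context {R : realType} {A : cstarAlgType R}.
Implicit Types H K M : hilbertModType A.

Definition ortho H (M : set H) : set H :=
  [set x | forall y, M y -> inner x y = 0].

(* H = M (+) M^perp, for a closed submodule M; the sum is always direct since
   the inner product is definite. *)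
Definition orth_complemented H (M : set H) : Prop :=
  forall x : H, exists y z : H, [/\ M y, ortho M z & x = y + z].

(* P is the projection P_M of H = M (+) M^perp onto M; it is determined by M. *)
Definition is_proj_onto H (M : set H) (P : 'L(H, H)) : Prop :=
  forall x : H, M (P x) /\ ortho M (x - P x).

Definition semi_regular H K (T : 'L(H, K)) : Prop :=
  orth_complemented (closure (range T)) /\
  orth_complemented (closure (range T^*L)).

Definition is_projection H (P : 'L(H, H)) : Prop :=
  P^*L = P /\ P \oL P = P.

Definition partial_isometry H K (U : 'L(H, K)) : Prop :=
  is_projection (U^*L \oL U).

(* Positivity in the C*-algebra L(H, H), defined as cstar_pos is. *)
Definition op_pos H (T : 'L(H, H)) : Prop :=
  exists B : 'L(H, H), T = B^*L \oL B.

Definition is_sqrt_op H (S T : 'L(H, H)) : Prop :=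
  op_pos T /\ T \oL T = S.

(* U is the partial isometry U_T associated with T; when T is semi-regular there
   is exactly one. *)
Definition is_assoc_partial_isometry H K (T U : 'L(H, K)) : Prop :=
  [/\ partial_isometry U,
      exists2 S : 'L(H, H), is_sqrt_op (T^*L \oL T) S & T = U \oL S
    & is_proj_onto (closure (range T^*L)) (U^*L \oL U)].

Definition is_reduced_solution H K M (T : 'L(H, K)) (C : 'L(M, K))
    (D : 'L(M, H)) : Prop :=
  T \oL D = C /\ range D `<=` closure (range T^*L).

End Notions.

(* Main.v *)
Require Import Defs.
From mathcomp Require Import all_boot all_order all_algebra.
From mathcomp Require Import complex.
From mathcomp Require Import boolp classical_sets reals topology normedtype.
From mathcomp Require Import ring.

(** Write [M] for the closure of the range of [A^*]. Orthogonality to [M] is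
the same as being killed by [A] ([ker_ortho], [ortho_ker]), so [A] is injective
on [M] ([closure_range_inj]). This gives uniqueness of the reduced solution. It
also gives the form of the general solution ([general_solution]): with [P] the
projection onto [M] one has [A P = A], hence [A X = C] holds exactly when
[P X = D], that is when [X = D + (1 - P) X].

The substance is the existence of [D] when the range of [C] lies in that of
[A]. As [M] is complemented, each [C x] has a preimage [D x] in [M]; what must
be shown is that the map [D] has an adjoint. On the range of [A^*] the adjoint
can only be [A^* y |-> C^* y], because [<D x, A^* y> = <A D x, y> = <x, C^* y>].
It has to be extended to [M] by continuity ([dual_on_closure]) and by [0] on
the complement, so an estimate [|C^* y| <= c |A^* y|] is needed
([range_majorization]). This follows from the uniform boundedness principle:
the vectors [C^* y] with [|A^* y| <= 1] satisfy
[<C^* y, x> = <A^* y, h>] for any [h] with [A h = C x], so their inner products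
with each fixed [x] are bounded, and a set of vectors with this property is
norm bounded ([weakly_bounded]).

The module norm is given by [|x|^2 = |<x, x>|] and satisfies the triangle
inequality, so polarization alone gives [|<x, y>| <= 6 |x| |y|]
([inner_bound]), which serves as well as the Cauchy-Schwarz inequality because
only boundedness and continuity are at stake. *)

Set Implicit Arguments.
Unset Strict Implicit.
Unset Printing Implicit Defensive.

Import Order.TTheory GRing.Theory Num.Theory.
Import numFieldNormedType.Exports.
Local Open Scope classical_set_scope.
Local Open Scope ring_scope.
Local Open Scope complex_scope.

(** * Convergence at rate 1/(n+1) over complex scalars *)

(** The archimedean property passes from [R] to [R[i]] because nonnegative
complex numbers are real. *)
Lemma lt_natc (R : realType) (x : R[i]) : 0 <= x -> exists n : nat, x < n.+1%:R.
Proof.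
move=> x0; exists (Num.bound (complex.Re x)).
have xE := RRe_real (ger0_real x0).
rewrite -xE -[_%:R](rmorph_nat (real_complex R)) ltcR.
apply: (lt_trans (archi_boundP _)); first by rewrite -ler0c xE.
by rewrite ltr_nat.
Qed.

Lemma rate_lt (R : realType) (M e : R[i]) : 0 <= M -> 0 < e ->
  exists n : nat, M / n.+1%:R < e.
Proof.
move=> M0 e0; have [n ltn] := lt_natc (divr_ge0 M0 (ltW e0)); exists n.
by rewrite ltr_pdivrMr ?ltr0n // mulrC -ltr_pdivrMr.
Qed.

Lemma norm_le_rate_eq0 (R : realType) (V : normedModType R[i]) (v : V)
    (M : R[i]) :
  0 <= M -> (forall n : nat, `|v| <= M / n.+1%:R) -> v = 0.
Proof.
move=> M0 vM; apply/eqP; rewrite -normr_eq0; apply/negPn/negP => v0.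
have [|n /lt_geF] := @rate_lt R M `|v| M0; first by rewrite lt_def v0 normr_ge0.
by rewrite vM.
Qed.

(** Completeness together with an explicit bound on the error: both limits taken
below need the distance of the limit to each term. *)
Lemma cvg_rate (R : realType) (V : completeNormedModType R[i])
    (x : nat -> V) (M : R[i]) : 0 <= M ->
    (forall n m : nat, (n <= m)%N -> `|x m - x n| <= M / n.+1%:R) ->
  exists l, forall n : nat, `|l - x n| <= M / n.+1%:R.
Proof.
move=> M0 xM.
have cx : cvg (x @ \oo).
  apply: cauchy_cvg; apply: cauchy_exP => e e0; have [n Mn] := rate_lt M0 e0.
  exists (x n); exists n => // m /= nm.
  by rewrite -ball_normE /= distrC (le_lt_trans (xM _ _ nm)).
exists (lim (x @ \oo)) => n; apply/ler_addgt0Pl => e e0.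
have [N _ xN] := (cvgrPdist_lt _ _).1 cx e e0.
have := xN (maxn N n) (leq_maxl _ _).
move=> /ltW /lerD /(_ (xM n _ (leq_maxr N n))); apply: le_trans.
exact: ler_distD.
Qed.

Section HilbertModuleOperators.
Context {R : realType} {A : cstarAlgType R}.
Implicit Types H K L : hilbertModType A.

(** * Boundedness of the inner product *)

Lemma innerZl H (l : R[i]) (x y : H) : inner (l *: x) y = conjc l *: inner x y.
Proof. by rewrite inner_star innerZr starZ -inner_star. Qed.

Lemma innerBr H (x y z : H) : inner x (y - z) = inner x y - inner x z.
Proof. by rewrite innerDr innerNr. Qed.

Lemma innerBl H (x y z : H) : inner (x - y) z = inner x z - inner y z.
Proof. by rewrite innerDl innerNl. Qed.

(** Two squares suffice instead of four, since the squares of the single vectors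
are subtracted explicitly. *)
Lemma inner_polar H (x y : H) :
  2 *: inner x y = (inner (x + y) (x + y) - inner x x - inner y y)
   - 'i%C *: (inner (x + 'i%C *: y) (x + 'i%C *: y) - inner x x
             - inner ('i%C *: y) ('i%C *: y)).
Proof.
rewrite !(innerDl, innerDr, innerZl, innerZr).
have -> : conjc 'i%C = - 'i%C :> R[i].
  by apply/eqP; rewrite eq_complex /= oppr0 !eqxx.
have ii : 'i%C * 'i%C = -1 :> R[i] by rewrite -expr2 sqr_i.
have cancel4 (a b c d : A) : a + b + (c + d) - a - d = b + c.
  by apply/eqP; rewrite !subr_eq [eqbRHS]addrC !addrA.
rewrite !cancel4 scalerDr !scalerA mulrN ii opprK scaleN1r scale1r.
rewrite scaler_nat mulr2n.
by rewrite opprD opprK [inner x y - _]addrC addrA addrK.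
Qed.

Lemma polar_term_le H (x y : H) : `|x| = 1 -> `|y| = 1 ->
  `|inner (x + y) (x + y) - inner x x - inner y y| <= 6.
Proof.
move=> x1 y1; apply: (le_trans (ler_normB _ _)).
rewrite -inner_norm y1 expr1n -[leRHS]/((5 + 1)%:R) natrD lerD //.
apply: (le_trans (ler_normB _ _)).
rewrite -!inner_norm x1 expr1n -[leRHS]/((4 + 1)%:R) natrD lerD //.
have h : `|x + y| <= 2 by rewrite (le_trans (ler_normD _ _)) // x1 y1.
by rewrite (_ : 4%:R = 2 ^+ 2) ?ler_sqr ?nnegrE // -natrX.
Qed.

(** A substitute for the Cauchy-Schwarz inequality: for unit vectors each
polarization term has norm at most [(1 + 1)^2 + 1 + 1 = 6], and the general case
follows by homogeneity. *)
Lemma inner_bound H (x y : H) : `|inner x y| <= 6 * (`|x| * `|y|).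
Proof.
have [->|x0] := eqVneq x 0; first by rewrite inner0l !normr0 mul0r mulr0.
have [->|y0] := eqVneq y 0; first by rewrite inner0r !normr0 !mulr0.
have nx0 : `|x| != 0 by rewrite normr_eq0.
have ny0 : `|y| != 0 by rewrite normr_eq0.
have normi : `|'i%C : R[i]| = 1 by rewrite complexiE normCi.
have unit_case (u v : H) : `|u| = 1 -> `|v| = 1 -> `|inner u v| <= 6.
  move=> u1 v1.
  have iv1 : `|'i%C *: v| = 1 by rewrite normrZ v1 mulr1 normi.
  have : `|2 *: inner u v| <= 6 + 6.
    rewrite inner_polar (le_trans (ler_normB _ _)) // lerD ?polar_term_le //.
    by rewrite normrZ normi mul1r polar_term_le.
  by rewrite normrZ normr_nat (_ : 6 + 6 = 2 * 6) ?ler_pM2l // -natrD -natrM.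
have unitize (u : H) : `|u| != 0 -> `| `|u|^-1 *: u| = 1.
  by move=> u0; rewrite normrZ normfV normr_id mulVf.
have scaleK (u : H) : `|u| != 0 -> u = `|u| *: (`|u|^-1 *: u).
  by move=> u0; rewrite scalerA mulfV ?scale1r.
rewrite {1}(scaleK x nx0) {1}(scaleK y ny0) innerZl innerZr scalerA.
rewrite normrZ normrM normcJ !normr_id mulrC.
by rewrite ler_wpM2r ?mulr_ge0 // unit_case ?unitize.
Qed.

(** * Uniform boundedness in a Hilbert module *)

(** The inductive step of the nested balls argument. Moving from [x] by [r / 2]
in the direction of a very long [w] in [F] makes [<w, _>] large, as
[<w, w> / |w|] has norm [|w|] while [<w, x>] stays below a bound independent of
[w]. By continuity it remains large on a small ball around the new point. *)
Lemma unbounded_on_subball H (F : set H) :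
    (forall x, exists B : R[i], forall w, F w -> `|inner w x| <= B) ->
    (forall M : R[i], 0 <= M -> exists2 w, F w & M < `|w|) ->
  forall (n : nat) (x : H) (r : R[i]), 0 < r -> r <= 1 ->
  exists (x' : H) (r' : R[i]),
    [/\ 0 < r', r' <= 1 / n.+1%:R, forall z, `|z - x'| <= r' -> `|z - x| <= r &
      exists2 w, F w & forall z, `|z - x'| <= r' -> n%:R <= `|inner w z| ].
Proof.
move=> Fweak Funb n x r r0 r1.
have [B FB] := Fweak x.
have B0 : 0 <= B.
  by have [w Fw _] := Funb 0 (lexx _); apply: le_trans (FB w Fw).
(* [M] is chosen so that [r / 2 * M = n.+1 + B] *)
pose M := 2 * (n.+1%:R + B) / r.
have M0 : 0 <= M by rewrite divr_ge0 ?mulr_ge0 ?addr_ge0 // ltW.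
have [w Fw Mw] := Funb M M0.
have w0 : 0 < `|w| by apply: le_lt_trans Mw.
pose u := (r / 2 / `|w|) *: w.
have r20 : 0 < r / 2 by rewrite divr_gt0.
have uE : `|u| = r / 2.
  by rewrite normrZ normrM normfV normr_id divfK ?gt_eqF // gtr0_norm.
have wu : n.+1%:R + B <= `|inner w u|.
  rewrite innerZr normrZ -inner_norm normrM normfV normr_id gtr0_norm //.
  rewrite expr2 mulrA divfK ?gt_eqF //.
  have -> : n.+1%:R + B = r / 2 * M by rewrite /M; field; rewrite gt_eqF.
  by rewrite ler_wpM2l ?ltW.
(* the factors of the denominator give [r' <= 1 / n.+1], [r' <= r / 2] and
   [6 |w| r' <= 1] respectively *)
pose a := 6 * `|w|; have a0 : 0 <= a by rewrite mulr_ge0.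
pose r' := r / (2 * n.+1%:R * (a + 1)).
have d0 : 0 < 2 * n.+1%:R * (a + 1) :> R[i].
  by rewrite !mulr_gt0 ?ltr0n // ltr_wpDl.
have n1 : 1 <= n.+1%:R :> R[i] by rewrite ler1n.
have a1 : 1 <= a + 1 by rewrite lerDr.
have r'0 : 0 < r' by rewrite divr_gt0.
have r'n : r' <= 1 / n.+1%:R.
  apply: ler_pM; rewrite ?invr_ge0 ?(ltW r0) ?(ltW d0) //.
  rewrite lef_pV2 ?posrE ?ltr0n //.
  by rewrite mulrAC ler_peMl ?ler0n // mulr_ege1 ?ler1n.
have r'2 : r' <= r / 2.
  rewrite /r' ler_pM2l // lef_pV2 ?posrE //.
  by rewrite -mulrA ler_peMr // mulr_ege1.
have ar' : a * r' <= 1.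
  rewrite mulrA ler_pdivrMr // mul1r (le_trans (ler_piMr a0 r1)) //.
  apply: (@le_trans _ _ (a + 1)); first by rewrite lerDl ler01.
  by rewrite ler_peMl ?(le_trans ler01 a1) // mulr_ege1 ?ler1n.
exists (x + u), r'; split => //.
- move=> z zx; rewrite (le_trans (ler_distD (x + u) z x)) // [x + u]addrC addrK.
  rewrite uE [leRHS](splitr r) lerD // (le_trans _ r'2) // addrC //.
- exists w => // z zx.
  have wxu : n.+1%:R <= `|inner w (x + u)|.
    rewrite -(lerD2r B) (le_trans wu) //.
    rewrite -[u in leLHS](addKr x) addrC innerBr.
    by rewrite (le_trans (ler_normB _ _)) // lerD // FB.
  have wz : `|inner w (x + u - z)| <= 1.
    rewrite (le_trans (inner_bound _ _)) // mulrA (le_trans _ ar') //.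
    by rewrite ler_wpM2l // distrC.
  rewrite -(lerD2r 1) natr1 (le_trans wxu) // -[x + u in leLHS](subrK z).
  by rewrite addrC innerDr (le_trans (ler_normD _ _)) // lerD2l.
Qed.

(** The uniform boundedness principle for the functionals [<w, _>]. If [F] were
unbounded, [unbounded_on_subball] would yield shrinking nested balls on the
[n]-th of which some [<w, _>] has norm at least [n]; their common point
contradicts the hypothesis. *)
Lemma weakly_bounded H (F : set H) :
    (forall x, exists B : R[i], forall w, F w -> `|inner w x| <= B) ->
  exists2 M : R[i], 0 <= M & forall w, F w -> `|w| <= M.
Proof.
move=> Fweak; apply: contrapT => nM.
have Funb (M : R[i]) : 0 <= M -> exists2 w, F w & M < `|w|.
  move=> M0; apply: contrapT => nw; apply: nM; exists M => // w Fw.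
  rewrite real_leNgt ?normr_real ?ger0_real //.
  by apply/negP => Mw; apply: nw; exists w.
(* [s] and [t] are successive balls, given as pairs (centre, radius) *)
pose P (n : nat) (s t : H * R[i]) := 0 < s.2 -> s.2 <= 1 ->
  [/\ 0 < t.2, t.2 <= 1 / n.+1%:R,
      forall z, `|z - t.1| <= t.2 -> `|z - s.1| <= s.2 &
      exists2 w, F w & forall z, `|z - t.1| <= t.2 -> n%:R <= `|inner w z| ].
have /choice[f fP] (ns : nat * (H * R[i])) : exists t, P ns.1 ns.2 t.
  case: ns => n [x r] /=.
  have [r01|r01] := pselect (0 < r /\ r <= 1); last first.
    by exists (0, 0) => /= r0 r1; case: r01.
  have [x' [r' ?]] := unbounded_on_subball Fweak Funb n x r01.1 r01.2.
  by exists (x', r').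
pose s := fix s n := if n is m.+1 then f (m, s m) else (0, 1).
have s01 n : 0 < (s n).2 /\ (s n).2 <= 1.
  elim: n => [|n [s0 s1]] /=; first by rewrite ltr01.
  have [t0 tn _ _] := fP (n, s n) s0 s1; split=> //.
  by rewrite (le_trans tn) // ler_pdivrMr ?ltr0n // mul1r ler1n.
have sP n := fP (n, s n) (s01 n).1 (s01 n).2.
have nested n m : (n <= m)%N ->
    forall z, `|z - (s m).1| <= (s m).2 -> `|z - (s n).1| <= (s n).2.
  elim: m => [|m IH]; first by rewrite leqn0 => /eqP ->.
  rewrite leq_eqVlt => /predU1P[->//|/IH {}IH z].
  by have [_ _ sub _] := sP m => /sub/IH.
have sdist n m : (n <= m)%N -> `|(s m).1 - (s n).1| <= (s n).2.
  by move=> nm; apply: (nested _ _ nm); rewrite subrr normr0 ltW // (s01 m).1.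
(* the shift by one is needed: the radius of ball [n.+1] is at most 1/(n+1) *)
have [l lP] := @cvg_rate R H (fun n => (s n.+1).1) 1 ler01
  (fun n m nm => le_trans (sdist n.+1 m.+1 nm)
    (let: And4 _ h _ _ := sP n in h)).
have ls n : `|l - (s n.+1).1| <= (s n.+1).2.
  apply/ler_addgt0Pl => e e0; have [m me] := rate_lt ler01 e0.
  rewrite (le_trans (ler_distD (s (maxn n m).+1).1 _ _)) // lerD //; last first.
    by rewrite sdist // ltnS leq_maxl.
  rewrite (le_trans (lP _)) // (le_trans _ (ltW me)) // ler_pM2l //.
  by rewrite lef_pV2 ?posrE ?ltr0n // ler_nat ltnS leq_maxr.
have [B FB] := Fweak l.
have B0 : 0 <= B by have [w Fw _] := Funb 0 (lexx _); apply: le_trans (FB w Fw).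
have [n Bn] := lt_natc B0.
have [_ _ _ [w Fw /(_ l (ls n.+1))]] := sP n.+1.
by move/le_trans => /(_ _ (FB w Fw)) /(lt_le_trans Bn); rewrite ltxx.
Qed.

(** * Adjointable operators and their kernels *)

Lemma inner_ext H (x y : H) : (forall z, inner x z = inner y z) -> x = y.
Proof.
move=> xy; apply/eqP; rewrite -subr_eq0; apply/eqP/inner_eq0.
by rewrite innerBl xy subrr.
Qed.

Lemma adj_dualPl H K (T : 'L(H, K)) x y : inner (T^*L x) y = inner x (T y).
Proof. by rewrite inner_star -adj_dualP -inner_star. Qed.

Lemma opD H K (T : 'L(H, K)) x y : T (x + y) = T x + T y.
Proof. by apply: inner_ext => z; rewrite adj_dualP !innerDl !adj_dualP. Qed.

Lemma opB H K (T : 'L(H, K)) x y : T (x - y) = T x - T y.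
Proof. by apply: inner_ext => z; rewrite adj_dualP !innerBl !adj_dualP. Qed.

Lemma opZ H K (T : 'L(H, K)) (l : R[i]) x : T (l *: x) = l *: T x.
Proof. by apply: inner_ext => z; rewrite adj_dualP !innerZl adj_dualP. Qed.

Lemma orthoC H (M : set H) (x y : H) : Defs.ortho M x -> M y -> inner y x = 0.
Proof. by move=> Mx My; rewrite inner_star Mx ?star0. Qed.

Lemma closure_rate H (M : set H) (h : H) : closure M h ->
  exists y : nat -> H, forall n : nat, M (y n) /\ `|h - y n| <= 1 / n.+1%:R.
Proof.
move=> Mh.
suff /choice[y yP] :
  forall n : nat, exists y, M y /\ `|h - y| <= 1 / n.+1%:R by exists y.
move=> n; have e0 : 0 < 1 / n.+1%:R :> R[i] by rewrite divr_gt0 ?ltr0n.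
have [y [My hy]] := Mh _ (nbhsx_ballx h _ e0).
by exists y; split=> //; move: hy; rewrite -ball_normE /= => /ltW.
Qed.

Lemma ker_ortho H K (T : 'L(H, K)) x :
  T x = 0 -> Defs.ortho (closure (range T^*L)) x.
Proof.
move=> Tx0 h /closure_rate[y yh].
apply: (@norm_le_rate_eq0 _ _ _ (6 * `|x|)); first by rewrite mulr_ge0.
move=> n; have [[k _ ky] hyn] := yh n.
have -> : inner x h = inner x (h - y n).
  by rewrite innerBr -ky -adj_dualP Tx0 inner0l subr0.
by rewrite (le_trans (inner_bound _ _)) // mulrA ler_wpM2l ?mulr_ge0 //
   -[leRHS]mul1r.
Qed.

Lemma ortho_ker H K (T : 'L(H, K)) x :
  Defs.ortho (closure (range T^*L)) x -> T x = 0.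
Proof.
move=> ox; apply/inner_eq0; rewrite adj_dualP.
by apply: ox; apply: subset_closure; exists (T x).
Qed.

(** The difference of the two vectors is orthogonal to the closure, hence to
itself. *)
Lemma closure_range_inj H K (T : 'L(H, K)) x y :
  closure (range T^*L) x -> closure (range T^*L) y -> T x = T y -> x = y.
Proof.
move=> Mx My Txy; have Tz : T (x - y) = 0 by rewrite opB Txy subrr.
apply/eqP; rewrite -subr_eq0; apply/eqP/inner_eq0.
by rewrite innerBr !(ker_ortho Tz) // subrr.
Qed.

(** * The reduced solution and the general solution *)

(** The family [C^* y], for [|T^* y| <= 1], is weakly bounded since its pairing
with [x] can be computed through a preimage of [C x]. *)
Lemma range_majorization H K L (T : 'L(H, K)) (C : 'L(L, K)) :
  range C `<=` range T ->
  exists2 M : R[i], 0 <= M & forall y, `|C^*L y| <= M * `|T^*L y|.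
Proof.
move=> CT.
have CTy x : exists h, forall y, inner (C^*L y) x = inner (T^*L y) h.
  have [h _ hx] : range T (C x) by apply: CT; exists x.
  by exists h => y; rewrite !adj_dualPl hx.
pose F := [set C^*L y | y in [set y | `|T^*L y| <= 1]].
have [|M M0 FM] := @weakly_bounded L F.
  move=> x; have [h xh] := CTy x; exists (6 * `|h|) => _ [y /= y1 <-].
  by rewrite xh (le_trans (inner_bound _ _)) // ler_wpM2l // ler_piMl.
(* when [T^* y = 0] normalization fails, but then [C^* y] is orthogonal to
   itself *)
exists M => // y; have [Ty0|Ty0] := eqVneq (T^*L y) 0.
  have [h yh] := CTy (C^*L y).
  have -> : C^*L y = 0 by apply: inner_eq0; rewrite yh Ty0 inner0l.
  by rewrite normr0 mulr_ge0.
have ny : 0 < `|T^*L y| by rewrite normr_gt0.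
have : `|C^*L (`|T^*L y|^-1 *: y)| <= M.
  apply: FM; exists (`|T^*L y|^-1 *: y) => //; rewrite /mkset.
  by rewrite opZ normrZ normfV normr_id mulVf ?gt_eqF.
by rewrite opZ normrZ normfV normr_id ler_pdivrMl // mulrC.
Qed.

(** Extension by continuity of [T^* y |-> C^* y] to the closure of the range.
The defining property of the extension is stated for every preimage [h'] of
[C x], so that it is available before any solution operator has been constructed. *)
Lemma dual_on_closure H K L (T : 'L(H, K)) (C : 'L(L, K)) :
  range C `<=` range T -> forall h, closure (range T^*L) h ->
  exists e, forall x h', T h' = C x -> inner h' h = inner x e.
Proof.
move=> /range_majorization[M M0 CM] h /closure_rate[t th].
have /choice[y yt] n : exists y, T^*L y = t n.
  by have [[y _ <-]] := th n; exists y.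
have tdist n m : (n <= m)%N -> `|t m - t n| <= 2 / n.+1%:R.
  move=> nm; rewrite (le_trans (ler_distD h _ _)) // mulr2n mulrDl lerD //;
    last by case: (th n).
  rewrite distrC; have [_] := th m => /le_trans; apply.
  by rewrite ler_pM2l // lef_pV2 ?posrE ?ltr0n // ler_nat.
have [|n m nm|e eP] := @cvg_rate R L (fun n => C^*L (y n)) (M * 2).
- by rewrite mulr_ge0.
- rewrite -opB (le_trans (CM _)) // -mulrA ler_wpM2l // opB !yt; exact: tdist.
exists e => x h' h'x.
apply/eqP; rewrite -subr_eq0; apply/eqP.
apply: (@norm_le_rate_eq0 _ _ _ (6 * `|h'| + 6 * (`|x| * (M * 2)))).
  by rewrite addr_ge0 // !mulr_ge0.
move=> n; have [_ htn] := th n.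
have -> : inner h' h - inner x e =
    inner h' (h - t n) - inner x (e - C^*L (y n)).
  by rewrite !innerBr -yt -!adj_dualP h'x opprB addrA subrK.
rewrite (le_trans (ler_normB _ _)) // mulrDl lerD //.
  by rewrite (le_trans (inner_bound _ _)) // mulrA ler_wpM2l ?mulr_ge0 //
   -[leRHS]mul1r.
rewrite (le_trans (inner_bound _ _)) //.
by rewrite -mulrA ler_wpM2l // -mulrA ler_wpM2l.
Qed.

(** The only issue is that the pointwise choice of preimages has an adjoint,
which also makes it linear and bounded. *)
Lemma reduced_solution_exists H K L (T : 'L(H, K)) (C : 'L(L, K)) :
  orth_complemented (closure (range T^*L)) -> range C `<=` range T ->
  exists D : 'L(L, H), is_reduced_solution T C D.
Proof.
move=> oT CT.
have /choice[D DP] x : exists d, closure (range T^*L) d /\ T d = C x.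
  have [h _ hx] : range T (C x) by apply: CT; exists x.
  have [d [z [Md oz hE]]] := oT h; exists d; split=> //.
  by rewrite -hx hE opD (ortho_ker oz) addr0.
have /choice[E EP] h : exists e, forall x, inner (D x) h = inner x e.
  have [p [q [Mp oq ->]]] := oT h; have [e eP] := dual_on_closure CT Mp.
  exists e => x; have [MDx TDx] := DP x.
  by rewrite innerDr (orthoC oq MDx) addr0 (eP x).
have DE : exists S : H -> L, forall x h, inner (D x) h = inner x (S h).
  by exists E => x h; apply: EP.
exists (Adjointable DE); split.
  by apply: adjointable_ext => x /=; case: (DP x).
by move=> _ [x _ <-] /=; case: (DP x).
Qed.

Lemma reduced_solution_unique H K L (T : 'L(H, K)) (C : 'L(L, K))
    (D D' : 'L(L, H)) :
  is_reduced_solution T C D -> is_reduced_solution T C D' -> D = D'.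
Proof.
move=> [TD MD] [TD' MD']; apply: adjointable_ext => x.
apply: (@closure_range_inj _ _ T); first by apply: MD; exists x.
  by apply: MD'; exists x.
by rewrite -[T (D x)]/((T \oL D) x) TD -TD'.
Qed.

(** Both directions rest on [T P = T]; solutions [X] satisfy [P X = D], so
[Y = X] serves as parameter. *)
Lemma general_solution H K L (T : 'L(H, K)) (C : 'L(L, K)) (D : 'L(L, H))
    (P : 'L(H, H)) :
  is_reduced_solution T C D -> is_proj_onto (closure (range T^*L)) P ->
  forall X : 'L(L, H), T \oL X = C <->
    exists Y : 'L(L, H), X = D + (idop H - P) \oL Y.
Proof.
move=> [TD MD] PP X.
have TP h : T (P h) = T h.
  by apply/eqP; rewrite eq_sym -subr_eq0 -opB (ortho_ker (PP h).2).
split=> [TX|[Y ->]].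
  exists X; apply: adjointable_ext => x /=.
  suff -> : D x = P (X x) by rewrite addrC subrK.
  apply: (@closure_range_inj _ _ T);
    [by apply: MD; exists x | exact: (PP _).1 |].
  by rewrite TP -[T (D x)]/((T \oL D) x) TD -TX.
apply: adjointable_ext => x /=.
by rewrite opD opB TP subrr addr0 -[T (D x)]/((T \oL D) x) TD.
Qed.
End HilbertModuleOperators.

Theorem theorem2p4 (R : realType) (Alg : cstarAlgType R)
    (H K L : hilbertModType Alg) (A : 'L(H, K)) (hA : semi_regular A)
    (C : 'L(L, K)) :
  ((exists X : 'L(L, H), A \oL X = C) <-> range C `<=` range A) /\
  (range C `<=` range A ->
    exists D : 'L(L, H),
      unique (is_reduced_solution A C) D /\
      forall U : 'L(H, K), is_assoc_partial_isometry A U ->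
      forall X : 'L(L, H),
        A \oL X = C <->
        exists Y : 'L(L, H), X = D + (idop H - U^*L \oL U) \oL Y).
Proof.
have exD : range C `<=` range A ->
    exists D : 'L(L, H), is_reduced_solution A C D.
  by apply: reduced_solution_exists; case: hA.
split.
  split=> [[X <-] _ [x _ <-]|/exD[D [AD _]]]; last by exists D.
  by exists (X x).
move=> /exD[D redD]; exists D; split.
  by split=> // D'; apply: reduced_solution_unique.
by move=> U [_ _ projU]; apply: general_solution.
Qed.
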